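(* Let $p$ be a prime, $\mathbb{F}_q$ a finite field of characteristic $p$, $n\ge1$, $s_1,\dots,s_n$ positive integers, and $m_1,\dots,m_n$ nonnegative integers. Let $$C=\langle (x_1-1)^{m_1}\cdots(x_n-1)^{m_n}\rangle\subset\mathcal{R}=\frac{\mathbb{F}_q[x_1,\dots,x_n]}{\langle x_1^{p^{s_1}}-1,\dots,x_n^{p^{s_n}}-1\rangle}.$$ For $1\le\ell\le n$ define $$Q_\ell=\{\vec a=(a_1,\dots,a_n)\in\mathbb{N}^n:\ 0\le a_\ell<m_\ell,\ 0\le a_j<p^{s_j}\text{ for } j\ne\ell\},$$ and let $Q=\bigcup_{\ell=1}^n Q_\ell$. Then, for $g\in\mathcal{R}$, we have $g\in C$ if and only if $D^{[\vec a]}(g)(1,\dots,1)=0$ for all $\vec a\in Q$.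
   Context: $\mathbb{N}=\{0,1,2,\dots\}$. Each element of $\mathcal{R}$ is identified with its unique polynomial representative $g=\sum g_{(i_1,\dots,i_n)}x_1^{i_1}\cdots x_n^{i_n}$ with $0\le i_j<p^{s_j}$. Hasse derivative: for $g=\sum d_{i_1,\dots,i_n}x_1^{i_1}\cdots x_n^{i_n}\in\mathbb{F}_q[x_1,\dots,x_n]$ and $\vec a=(a_1,\dots,a_n)\in\mathbb{N}^n$, $$D^{[\vec a]}(g)=\sum d_{i_1,\dots,i_n}\binom{i_1}{a_1}\cdots\binom{i_n}{a_n}x_1^{i_1-a_1}\cdots x_n^{i_n-a_n},$$ where $\binom{i}{a}=0$ whenever $i<a$. $D^{[\vec a]}(g)(1,\dots,1)$ denotes its evaluation at $(1,\dots,1)$. *)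

(* Defs.v *)
From HB Require Import structures.
From mathcomp Require Import all_boot all_order all_algebra.
From mathcomp Require Import boolp.
From mathcomp Require Import ssrcomplements mpoly.
From mathcomp Require Import generic_quotient ring_quotient.

Set Implicit Arguments.
Unset Strict Implicit.
Unset Printing Implicit Defensive.

Import GRing.Theory.

Local Open Scope ring_scope.
Local Open Scope quotient_scope.

(* The quotient construction of ring_quotient needs a boolean ideal predicate;
   membership in a finitely generated ideal is made boolean classically. *)
Definition ideal_gen (A : comNzRingType) (I : finType) (f : I -> A) :
    {pred A} :=
  [pred g | `[< exists h : I -> A, g = \sum_(i : I) h i * f i >]].

Lemma ideal_genP (A : comNzRingType) (I : finType) (f : I -> A) (g : A) :
  reflect (exists h : I -> A, g = \sum_(i : I) h i * f i) (g \in ideal_gen f).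
Proof. by rewrite inE; exact: asboolP. Qed.

Definition period_ideal (F : fieldType) (n : nat) (N : 'I_n -> nat) :
    {pred {mpoly F[n]}} :=
  ideal_gen (fun j : 'I_n => 'X_j ^+ N j - 1).

Lemma period_ideal_closed (F : fieldType) (n : nat) (N : 'I_n -> nat) :
  idealr_closed (@period_ideal F n N).
Proof.
split.
- by apply/ideal_genP; exists (fun=> 0); rewrite big1 // => i _; rewrite mul0r.
- apply/negP => /ideal_genP[h /(congr1 (meval (fun=> 1)))].
  rewrite meval1 rmorph_sum big1 => [|i _ /=]; first by apply/eqP/oner_neq0.
  by rewrite rmorphM rmorphB rmorphXn /= mevalXU expr1n meval1 subrr mulr0.
- move=> a u v /ideal_genP[h ->] /ideal_genP[k ->]; apply/ideal_genP.
  exists (fun i => a * h i + k i); rewrite mulr_sumr -big_split /=.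
  by apply: eq_bigr => i _; rewrite mulrDl mulrA.
Qed.

HB.instance Definition _ (F : fieldType) (n : nat) (N : 'I_n -> nat) :=
  isIdealr.Build {mpoly F[n]} (@period_ideal F n N)
    (@period_ideal_closed F n N).

(* F[x_1, ..., x_n] / <x_j ^ N_j - 1 : j>, where N_j = p ^ s_j in the
   theorem. *)
Definition period_ring (F : fieldType) (n : nat) (N : 'I_n -> nat) :
    comNzRingType :=
  {ideal_quot (@period_ideal F n N)}.

Definition period_pi (F : fieldType) (n : nat) (N : 'I_n -> nat)
    (f : {mpoly F[n]}) : period_ring F N :=
  \pi_{ideal_quot (@period_ideal F n N)} f.

HB.instance Definition _ (F : fieldType) (n : nat) (N : 'I_n -> nat) :=
  GRing.RMorphism.copy (@period_pi F n N)
    (\pi_{ideal_quot (@period_ideal F n N)}).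

Lemma period_pi_eq (F : fieldType) (n : nat) (N : 'I_n -> nat)
    (f g : {mpoly F[n]}) :
  (period_pi N f == period_pi N g) = (f - g \in period_ideal N).
Proof. by rewrite [RHS]Quotient.idealrBE. Qed.

Lemma period_pi_X (F : fieldType) (n : nat) (N : 'I_n -> nat) (j : 'I_n) :
  period_pi N ('X_j : {mpoly F[n]}) ^+ N j = 1.
Proof.
rewrite -rmorphXn -[RHS](rmorph1 (@period_pi F n N)); apply/eqP.
rewrite period_pi_eq; apply/ideal_genP; exists (fun i => (i == j)%:R).
rewrite (bigD1 j) //= eqxx mul1r big1 ?addr0 // => i /negPf->.
by rewrite mul0r.
Qed.

Definition mnm_reduce (n : nat) (N : 'I_n -> nat) (u : 'X_{1..n}) : 'X_{1..n} :=
  [multinom (u i %% N i)%N | i < n].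

Definition mpoly_reduce (F : fieldType) (n : nat) (N : 'I_n -> nat)
    (f : {mpoly F[n]}) : {mpoly F[n]} :=
  \sum_(u <- msupp f) f@_u *: 'X_[mnm_reduce N u].

Definition reduced (F : fieldType) (n : nat) (N : 'I_n -> nat) :
    {pred {mpoly F[n]}} :=
  [pred f | all (fun u : 'X_{1..n} => [forall i : 'I_n, u i < N i]%N) (msupp f)].

(* The unique representative with all exponents of x_j below N_j: see
   period_reprK, period_repr_reduced and period_repr_unique. *)
Definition period_repr (F : fieldType) (n : nat) (N : 'I_n -> nat)
    (g : period_ring F N) : {mpoly F[n]} :=
  mpoly_reduce N (repr g).

Section ReducedRepr.

Context (F : fieldType) (n : nat) (N : 'I_n -> nat).
Implicit Types f g : {mpoly F[n]}.

Lemma mpoly_reduceE f k : (msize f <= k)%N ->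
  mpoly_reduce N f = \sum_(u : 'X_{1..n < k}) f@_u *: 'X_[mnm_reduce N u].
Proof.
move=> le_fk; pose I : subFinType _ := 'X_{1..n < k}.
rewrite /mpoly_reduce (big_mksub I) ?msupp_uniq //=; first last.
  by move=> x /msize_mdeg_lt /leq_trans; apply.
rewrite big_rmcond //= => j /memN_msupp_eq0 ->.
by rewrite scale0r.
Qed.

Lemma mpoly_reduce_is_linear : linear (@mpoly_reduce F n N).
Proof.
move=> c f g; pose k := maxn (msize (c *: f + g)) (maxn (msize f) (msize g)).
rewrite !(@mpoly_reduceE _ k) ?leq_max ?leqnn ?orbT //.
rewrite scaler_sumr -big_split /=; apply: eq_bigr => u _.
by rewrite mcoeffD mcoeffZ scalerDl scalerA.
Qed.

HB.instance Definition _ :=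
  GRing.isLinear.Build F {mpoly F[n]} {mpoly F[n]} _ (@mpoly_reduce F n N)
    mpoly_reduce_is_linear.

Lemma mpoly_reduceX (u : 'X_{1..n}) :
  mpoly_reduce N ('X_[u] : {mpoly F[n]}) = 'X_[mnm_reduce N u].
Proof. by rewrite /mpoly_reduce msuppX big_seq1 mcoeffX eqxx scale1r. Qed.

Lemma mpoly_reduce_ideal f : f \in period_ideal N -> mpoly_reduce N f = 0.
Proof.
case/ideal_genP=> h ->; rewrite linear_sum big1 // => j _ /=.
rewrite [h j]mpolyE mulr_suml linear_sum big1 //= => u _.
rewrite mulrBr mulr1 mpolyXn -scalerAl -mpolyXD linearB /= !linearZ /=.
rewrite !mpoly_reduceX (_ : mnm_reduce N _ = mnm_reduce N u) //; last first.
  apply/mnmP => i; rewrite !mnmE mulmnE mnm1E.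
  by case: eqP => [->|_]; rewrite ?mul1n ?modnDr // mul0n addn0.
by rewrite scalerN subrr.
Qed.

Lemma mpoly_reduce_pi f : period_pi N (mpoly_reduce N f) = period_pi N f.
Proof.
rewrite [in RHS](mpolyE f) !rmorph_sum /=; apply: eq_bigr => u _.
rewrite -!mul_mpolyC !rmorphM /=; congr (_ * _).
rewrite !mpolyXE_id !rmorph_prod /=; apply: eq_bigr => i _.
rewrite !rmorphXn /= mnmE {2}(divn_eq (u i) (N i)) exprD mulnC exprM.
by rewrite period_pi_X expr1n mul1r.
Qed.

Lemma mpoly_reduce_id f : f \in reduced N -> mpoly_reduce N f = f.
Proof.
move=> /allP red_f; rewrite [RHS]mpolyE; apply: eq_big_seq => u /red_f.
move=> /forallP lt_u; congr (_ *: 'X_[_]).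
by apply/mnmP => i; rewrite mnmE modn_small.
Qed.

Lemma period_reprK (g : period_ring F N) : period_pi N (period_repr g) = g.
Proof. by rewrite mpoly_reduce_pi /period_pi reprK. Qed.

Lemma period_repr_reduced (g : period_ring F N) :
  (forall i, 0 < N i)%N -> period_repr g \in reduced N.
Proof.
move=> N_gt0; apply/allP => u /msupp_sum_le /flatten_mapP[v _].
move=> /msuppZ_le; rewrite msuppX inE => /eqP->.
by apply/forallP => i; rewrite mnmE ltn_mod.
Qed.

Lemma period_repr_unique f (g : period_ring F N) :
  f \in reduced N -> period_pi N f = g -> f = period_repr g.
Proof.
move=> red_f fg; rewrite -{1}(mpoly_reduce_id red_f); apply/eqP.
rewrite -subr_eq0 -linearB /= mpoly_reduce_ideal // -period_pi_eq.
by rewrite fg /period_pi reprK.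
Qed.

End ReducedRepr.

(* Multinomial subtraction truncates, but the coefficient vanishes as soon as
   u j < a j for some j. *)
Definition hasse (F : fieldType) (n : nat) (a : 'X_{1..n}) (g : {mpoly F[n]}) :
    {mpoly F[n]} :=
  \sum_(u <- msupp g)
    (g@_u * (\prod_(j < n) 'C(u j, a j))%N%:R) *: 'X_[u - a].

Definition period_X (F : fieldType) (n : nat) (N : 'I_n -> nat) (j : 'I_n) :
    period_ring F N := period_pi N 'X_j.

(* The principal ideal of the quotient ring generated by
   (x_1 - 1) ^ m_1 ... (x_n - 1) ^ m_n. *)
Definition monomial_code (F : fieldType) (n : nat) (N m : 'I_n -> nat) :
    {pred period_ring F N} :=
  ideal_gen (fun _ : unit => \prod_(j < n) (period_X F N j - 1) ^+ m j).

Arguments monomial_code F {n} N m.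

Definition hasse_box (n : nat) (N m : 'I_n -> nat) (l : 'I_n) :
    {pred 'X_{1..n}} :=
  [pred a : 'X_{1..n} |
    (a l < m l)%N && [forall (j : 'I_n | j != l), (a j < N j)%N]].

Definition hasse_set (n : nat) (N m : 'I_n -> nat) : {pred 'X_{1..n}} :=
  [pred a : 'X_{1..n} | [exists l : 'I_n, a \in hasse_box N m l]].

(* Main.v *)
(* Substituting x_j + 1 for x_j turns D^[a](g)(1, ..., 1) into the coefficient
   of x^a. In characteristic p it also maps x_j ^ N_j - 1 to x_j ^ N_j, so in
   the shifted variables every ideal involved is a monomial ideal: g lies in C
   iff every monomial x^a occurring in the shifted g is divisible by x^m or by
   some x_j ^ N_j. A monomial failing this has a in Q; the remaining a in Q
   have some a_j >= N_j, where D^[a] kills every reduced polynomial. *)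
From HB Require Import structures.
Require Import Defs.
From mathcomp Require Import all_boot all_order all_algebra.
From mathcomp Require Import mpoly.

Set Implicit Arguments.
Unset Strict Implicit.
Unset Printing Implicit Defensive.

Import GRing.Theory.

Local Open Scope ring_scope.

Lemma mcoeffMX_eq0 (R : comNzRingType) (n : nat) (f : {mpoly R[n]})
    (k a : 'X_{1..n}) :
  ~~ (k <= a)%MM -> (f * 'X_[k])@_a = 0.
Proof.
move=> nle_ka; rewrite [f]mpolyE mulr_suml raddf_sum big1 //= => u _.
rewrite -scalerAl -mpolyXD mcoeffZ mcoeffX.
case: eqP => [Da|_]; last by rewrite mulr0.
by case/negP: nle_ka; rewrite -Da lem_addl.
Qed.

(** Expand every factor by the binomial theorem and distribute: the terms are indexed by choices of
    one exponent per variable, and only the choice [a] yields the monomial ['X_[a]]. *)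
Lemma mcoeff_prod_XD1 (R : comNzRingType) (n : nat) (u a : 'X_{1..n}) :
  (\prod_(j < n) ('X_j + 1 : {mpoly R[n]}) ^+ u j)@_a =
    (\prod_(j < n) 'C(u j, a j))%N%:R.
Proof.
(* A common bound on all [u j] and [a j], so that one index type ['I_k.+1] serves every factor; the
   added binomials vanish. *)
pose k := (mdeg u + mdeg a)%N.
have le_mdeg (v : 'X_{1..n}) j : (v j <= mdeg v)%N.
  by rewrite mdegE (bigD1 j) //= leq_addr.
have le_uk j : (u j <= k)%N by rewrite (leq_trans (le_mdeg u j)) // leq_addr.
have le_ak j : (a j <= k)%N by rewrite (leq_trans (le_mdeg a j)) // leq_addl.
have XD1 j : ('X_j + 1 : {mpoly R[n]}) ^+ u j =
    \sum_(i < k.+1) 'X_j ^+ i *+ 'C(u j, i).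
  pose T i : {mpoly R[n]} := 1 ^+ (u j - i) * 'X_j ^+ i *+ 'C(u j, i).
  rewrite addrC exprDn (big_ord_widen k.+1 T) ?ltnS // big_mkcond.
  apply: eq_bigr => i _; rewrite /T expr1n mul1r ltnS.
  by case: leqP => // lt_ui; rewrite bin_small ?mulr0n.
rewrite (eq_bigr _ (fun j _ => XD1 j)) bigA_distr_bigA /= raddf_sum /=.
pose fa := [ffun j => inord (a j) : 'I_k.+1].
have prodE (f : {ffun 'I_n -> 'I_k.+1}) :
    \prod_j ('X_j ^+ f j *+ 'C(u j, f j) : {mpoly R[n]}) =
      'X_[[multinom (f j : nat) | j < n]] *+ (\prod_j 'C(u j, f j))%N.
  rewrite mpolyXE_id -mulr_natr natr_prod -big_split /=; apply: eq_bigr => j _.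
  by rewrite mulr_natr mnmE.
rewrite (bigD1 fa) //= [X in _ + X]big1 ?addr0 => [|f ne_f].
all: rewrite prodE mcoeffMn mcoeffX.
  rewrite (_ : [multinom _ | j < n] == a).
    by congr (_%:R); apply: eq_bigr => j _; rewrite ffunE inordK // ltnS.
  by apply/eqP/mnmP => j; rewrite mnmE ffunE inordK // ltnS.
case: eqP => [Da|_]; last by rewrite mul0rn.
case/eqP: ne_f; apply/ffunP => j; apply: val_inj.
by rewrite ffunE /= inordK ?ltnS // -Da mnmE.
Qed.

Definition mpoly_shift (R : comNzRingType) (n : nat) (c : R)
    (f : {mpoly R[n]}) : {mpoly R[n]} :=
  f \mPo [tuple 'X_j + c%:MP | j < n].

HB.instance Definition _ (R : comNzRingType) (n : nat) (c : R) :=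
  GRing.LRMorphism.copy (@mpoly_shift R n c)
    (comp_mpoly [tuple 'X_j + c%:MP | j < n]).

Lemma mpoly_shiftXU (R : comNzRingType) (n : nat) (c : R) (j : 'I_n) :
  mpoly_shift c 'X_j = 'X_j + c%:MP.
Proof. by rewrite /mpoly_shift comp_mpolyXU -tnth_nth tnth_mktuple. Qed.

Lemma mpoly_shiftX (R : comNzRingType) (n : nat) (c : R) (u : 'X_{1..n}) :
  mpoly_shift c 'X_[u] = \prod_(j < n) ('X_j + c%:MP) ^+ u j.
Proof.
by rewrite /mpoly_shift comp_mpolyX; apply: eq_bigr => j _; rewrite tnth_mktuple.
Qed.

Lemma mpoly_shiftNK (R : comNzRingType) (n : nat) (c : R) :
  cancel (@mpoly_shift R n c) (mpoly_shift (- c)).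
Proof.
move=> f; rewrite [f in LHS]mpolyE (linear_sum (@mpoly_shift R n c)) linear_sum.
rewrite [RHS]mpolyE; apply: eq_bigr => u _.
rewrite !linearZ /= mpoly_shiftX rmorph_prod mpolyXE_id /=; congr (_ *: _).
apply: eq_bigr => j _; rewrite rmorphXn rmorphD /= mpoly_shiftXU.
by rewrite [mpoly_shift _ c%:MP]comp_mpolyC mpolyCN addrNK.
Qed.

(** Taylor expansion at (1, ..., 1): both sides are linear in [f] and give the same product of
    binomials on monomials. *)
Lemma hasse_eval1 (F : fieldType) (n : nat) (a : 'X_{1..n}) (f : {mpoly F[n]}) :
  (hasse a f).@[fun=> 1] = (mpoly_shift 1 f)@_a.
Proof.
rewrite [f in RHS]mpolyE (linear_sum (@mpoly_shift F n 1)) /hasse.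
rewrite !raddf_sum /=; apply: eq_bigr => u _.
rewrite !linearZ /= mpoly_shiftX mpolyC1 mcoeff_prod_XD1.
rewrite mevalX [X in _ * X = _]big1 ?mulr1 // => j _; exact: expr1n.
Qed.

Lemma hasse_reduced_eq0 (F : fieldType) (n : nat) (N : 'I_n -> nat)
    (a : 'X_{1..n}) (f : {mpoly F[n]}) (j : 'I_n) :
  f \in reduced N -> (N j <= a j)%N -> hasse a f = 0.
Proof.
move=> /allP red_f le_Na; rewrite /hasse big_seq big1 // => u /red_f/forallP.
move=> /(_ j) lt_uN; rewrite (bigD1 j) //= bin_small ?(leq_trans lt_uN) //.
by rewrite mul0n mulr0 scale0r.
Qed.

(** Additivity of Frobenius applied to [x - y] and [y], which avoids computing the sign of a power
    of -1. *)
Lemma exprBn_pchar_pow (R : comNzRingType) (p s : nat) (x y : R) :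
  p \in [pchar R] -> (x - y) ^+ (p ^ s) = x ^+ (p ^ s) - y ^+ (p ^ s).
Proof.
move=> charR; apply: (addIr (y ^+ (p ^ s))).
rewrite addrNK -exprDn_pchar.
  by rewrite addrNK.
by rewrite pnatX pnatE ?(pcharf_prime charR) // charR.
Qed.

Theorem theorem5p3 (p : nat) (p_prime : prime p)
    (F : finFieldType) (charF : p \in [pchar F])
    (n : nat) (n_ge1 : (1 <= n)%N)
    (s : 'I_n -> nat) (s_gt0 : forall j, (0 < s j)%N)
    (m : 'I_n -> nat)
    (g : period_ring F (fun j => p ^ s j)%N) :
  g \in monomial_code F (fun j => p ^ s j)%N m <->
  (forall a : 'X_{1..n}, a \in hasse_set (fun j => p ^ s j)%N m ->
     (hasse a (period_repr g)).@[fun=> 1] = 0).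
Proof.
set N := fun j => (p ^ s j)%N in g *.
have N_gt0 j : (0 < N j)%N by rewrite expn_gt0 prime_gt0.
have charP : p \in [pchar {mpoly F[n]}] by exact: (rmorph_pchar (@mpolyC n F)).
have charQ : p \in [pchar period_ring F N].
  exact: (rmorph_pchar (@period_pi F n N)).
pose mm := [multinom m j | j < n].
pose f := period_repr g.
have piX1 j : period_pi N ('X_j - 1) = period_X F N j - 1.
  by rewrite rmorphB rmorph1.
have red_f : f \in reduced N by exact: period_repr_reduced.
split=> [/ideal_genP[h gE] a /existsP[l /andP[lt_aml /forall_inP lt_aN]]|Q0].
  (* Membership in the box bounds [a l] by [m l] only, and [m l] may exceed [N l]. *)
  have [le_Na|lt_aNl] := leqP (N l) (a l).
    by rewrite (hasse_reduced_eq0 red_f le_Na) meval0.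
  have {lt_aN}lt_aN j : (a j < N j)%N by have [->|/lt_aN] := eqVneq j l.
  rewrite hasse_eval1.
  (* A polynomial lift of the cofactor: [f] equals [H] times the generator modulo the period
     ideal. *)
  pose H := repr (h tt).
  have /eqP: period_pi N f = period_pi N (H * \prod_j ('X_j - 1) ^+ m j).
    rewrite period_reprK gE (big_pred1 tt) => [|[]//]; rewrite rmorphM /=.
    rewrite [period_pi N H]reprK; congr (_ * _); rewrite rmorph_prod /=.
    by apply: eq_bigr => j _; rewrite rmorphXn /= piX1.
  rewrite period_pi_eq => /ideal_genP[k /eqP]; rewrite subr_eq => /eqP fE.
  have shX1 j : mpoly_shift 1 ('X_j - 1 : {mpoly F[n]}) = 'X_j.
    by rewrite rmorphB rmorph1 /= mpoly_shiftXU addrK.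
  (* The shifted [f] is a multiple of ['X_[mm]] plus multiples of the ['X_j ^+ N j]. None of these
     monomials divides ['X_[a]], since [a l < m l] and every [a j < N j]. *)
  rewrite -/f fE rmorphD rmorph_sum mcoeffD raddf_sum big1 ?add0r /=.
    rewrite rmorphM rmorph_prod /= (eq_bigr (fun j => 'X_j ^+ mm j)).
      rewrite -mpolyXE_id mcoeffMX_eq0 //; apply/negP => /mnm_lepP/(_ l).
      by rewrite mnmE leqNgt lt_aml.
    by move=> j _; rewrite rmorphXn /= shX1 mnmE.
  (* Writing 1 as [1 ^+ N j] lets Frobenius turn the generator into [('X_j - 1) ^+ N j]. *)
  move=> j _; rewrite rmorphM -[X in 'X_j ^+ _ - X](expr1n _ (N j)) /=.
  rewrite -exprBn_pchar_pow // rmorphXn /= shX1 mpolyXn mcoeffMX_eq0 //.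
  apply/negP => /mnm_lepP/(_ j).
  by rewrite mulmnE mnm1E eqxx mul1n leqNgt lt_aN.
have X1N j : (period_X F N j - 1) ^+ N j = 0.
  by rewrite exprBn_pchar_pow // period_pi_X expr1n subrr.
pose G := \prod_j (period_X F N j - 1) ^+ m j.
suff [H gE]: exists H, g = H * G.
  by apply/ideal_genP; exists (fun=> H); rewrite (big_pred1 tt) => [|[]].
pose f1 := mpoly_shift 1 f.
(* Shifting back by -1 and projecting expands [g] in powers of the [period_X F N j - 1]. *)
have gE : g = \sum_(u <- msupp f1)
    period_pi N (f1@_u)%:MP * \prod_j (period_X F N j - 1) ^+ u j.
  rewrite -{1}[g]period_reprK -/f -{1}[f](mpoly_shiftNK 1).
  rewrite -/f1 [f1 in LHS]mpolyE linear_sum rmorph_sum /=.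
  apply: eq_bigr => u _; rewrite linearZ /= -mul_mpolyC rmorphM /=.
  congr (_ * _).
  rewrite mpoly_shiftX rmorph_prod /=; apply: eq_bigr => j _.
  by rewrite rmorphXn mpolyCN mpolyC1 /= piX1.
(* The cofactor keeps the terms divisible by [G], divided by it; the other terms are shown to vanish
   in the quotient. *)
exists (\sum_(u <- msupp f1 | (mm <= u)%MM)
  period_pi N (f1@_u)%:MP * \prod_j (period_X F N j - 1) ^+ (u j - m j)).
rewrite {1}gE mulr_suml [RHS]big_mkcond; apply: eq_big_seq => u u_supp.
case: ifPn => [/mnm_lepP le_mu | nle_mu].
  rewrite -mulrA -big_split /=; congr (_ * _); apply: eq_bigr => j _.
  by rewrite -exprD subnK //; have := le_mu j; rewrite mnmE.
suff [j le_Nu] : exists j, (N j <= u j)%N.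
  by rewrite (bigD1 j) //= -(subnK le_Nu) exprD X1N mulr0 mul0r mulr0.
(* If every [u j < N j], the [l] with [u l < m l] given by [nle_mu] puts [u] in Q, so [Q0] removes
   [u] from the support of [f1]. *)
apply/existsP; apply: contraTT u_supp; rewrite negb_exists => /forallP lt_uN.
rewrite mcoeff_msupp negbK -hasse_eval1 Q0 //.
move: nle_mu; rewrite -[(mm <= u)%MM]/[forall j, mm j <= u j]%N negb_forall.
case/existsP=> l; rewrite mnmE -ltnNge => lt_um; apply/existsP; exists l.
by apply/andP; split=> //; apply/forall_inP => j _; rewrite ltnNge.
Qed.
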